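(* Let $2<r<\infty$ and $r'=r/(r-1)$. (a) If $1\le p<r'$, then the inequality $\|\mathcal{V}^rS[f]\|_{L^p(\mathbb{T})}\le C\|f\|_{L^p(\mathbb{T})}$ does not hold for all $f\in L^p(\mathbb{T})$ with any finite constant $C$. (b) If $1\le s<\infty$, then the inequality $\|\mathcal{V}^rS[f]\|_{L^{r',s}(\mathbb{T})}\le C\|f\|_{L^{r',1}(\mathbb{T})}$ does not hold for all $f\in L^{r',1}(\mathbb{T})$ with any finite constant $C$.
   Context: $\mathbb{T}=\mathbb{R}/\mathbb{Z}$. For integrable $f$ on $\mathbb{T}$ and $k\in\mathbb{Z}$, $\widehat f_k=\int_0^1 f(y)e^{-2\pi i ky}\,dy$, and for $n\in\mathbb{N}_0$, $S_nf(x)=\sum_{k=-n}^n\widehat f_k e^{2\pi i kx}$. The $r$-variation is $$\mathcal{V}^rS[f](x)=\sup_K\ \sup_{0\le n_0<\cdots<n_K}\Big(\sum_{\ell=1}^K|S_{n_\ell}f(x)-S_{n_{\ell-1}}f(x)|^r\Big)^{1/r},$$ the supremum being over all $K$ and all increasing sequences of nonnegative integers. $L^{p,q}$ denotes Lorentz spaces. *)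

(* Defs.v *)
From HB Require Import structures.
From mathcomp Require Import all_boot all_order all_algebra.
From mathcomp.real_closed Require Import complex.
From mathcomp Require Import all_classical all_reals all_analysis.
Set Implicit Arguments.
Unset Strict Implicit.
Unset Printing Implicit Defensive.
Import Order.TTheory GRing.Theory Num.Theory.
Import numFieldNormedType.Exports.
Local Open Scope classical_set_scope.
Local Open Scope ring_scope.

(* Functions on the torus R/Z are represented by 1-periodic functions
   f : R -> R[i]; the normalized measure of R/Z is Lebesgue measure on the
   fundamental domain [0, 1] (the two endpoints, identified in R/Z, are null). *)
Definition torus_measure (R : realType) : {measure set measurableTypeR R -> \bar R} :=
  mrestr (@lebesgue_measure R) (measurable_itv `[(0 : R), 1]).

Definition cmod (R : realType) (z : R[i]) : R := ComplexField.Normc.normc z.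

(* cis t = e^{i t} *)
Definition cis (R : realType) (t : R) : R[i] := Complex (cos t) (sin t).

Definition cintegral01 (R : realType) (f : R -> R[i]) : R[i] :=
  Complex (\int[@lebesgue_measure R]_(y in `[0, 1]) complex.Re (f y))%R
          (\int[@lebesgue_measure R]_(y in `[0, 1]) complex.Im (f y))%R.

Definition fourier_coef (R : realType) (f : R -> R[i]) (k : int) : R[i] :=
  cintegral01 (fun y => f y * cis (- (2 * pi * k%:~R * y))).

(* The index i in {0, ..., 2n} stands for the frequency k = i - n. *)
Definition fourier_sum (R : realType) (f : R -> R[i]) (n : nat) (x : R) : R[i] :=
  \sum_(i < n.*2.+1)
    let k : int := i%:Z - n%:Z in
    fourier_coef f k * cis (2 * pi * k%:~R * x).

(* Only n 0, ..., n K matter among the values of n : nat -> nat. *)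
Definition fourier_variation (R : realType) (r : R) (f : R -> R[i]) (x : R) : \bar R :=
  ereal_sup [set v | exists (K : nat) (n : nat -> nat),
    (forall l, (l < K)%N -> (n l < n l.+1)%N) /\
    v = ((\sum_(1 <= l < K.+1)
           (cmod (fourier_sum f (n l) x - fourier_sum f (n l.-1) x)) `^ r)
         `^ r^-1)%:E].

Definition measurable_torus_fun (R : realType) (f : R -> R[i]) : Prop :=
  [/\ forall x, f (x + 1) = f x,
      measurable_fun [set: measurableTypeR R] (fun x : measurableTypeR R => complex.Re (f x)) &
      measurable_fun [set: measurableTypeR R] (fun x : measurableTypeR R => complex.Im (f x))].

Definition abs_fun (R : realType) (f : R -> R[i]) (x : R) : \bar R :=
  (cmod (f x))%:E.

Section Lorentz.
Context d (T : measurableType d) (R : realType).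
Variable mu : {measure set T -> \bar R}.
Local Open Scope ereal_scope.

Definition distribution_function (g : T -> \bar R) (s : R) : \bar R :=
  mu [set x | s%:E < `|g x|].

Definition decreasing_rearrangement (g : T -> \bar R) (t : R) : \bar R :=
  ereal_inf [set s%:E | s in
    [set s : R | (0 <= s)%R /\ distribution_function g s <= t%:E]].

(* The Lorentz quasi-norm for finite p and q:
   (int_0^oo (t^(1/p) g^*(t))^q dt/t)^(1/q). *)
Definition lorentz_norm (p q : R) (g : T -> \bar R) : \bar R :=
  (\int[@lebesgue_measure R]_(t in `]0%R, +oo[)
     (((t `^ p^-1)%R%:E * decreasing_rearrangement g t) `^ q * (t^-1)%:E))
  `^ q^-1.

End Lorentz.

Definition in_Lp (R : realType) (p : R) (f : R -> R[i]) : Prop :=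
  measurable_torus_fun f /\
  ('N[torus_measure R]_(p%:E) [abs_fun f] < +oo)%E.

Definition in_Lorentz (R : realType) (p q : R) (f : R -> R[i]) : Prop :=
  measurable_torus_fun f /\
  (lorentz_norm (torus_measure R) p q (abs_fun f) < +oo)%E.

(* Main.v *)
(* For [f] the periodic indicator of ]0, a[ with [a = 1/(16 N)], all frequencies
   [k <= N] satisfy [k y <= 1/16] on the support of [f]. Hence, when [k x] is
   within 1/16 of an integer, the frequencies [k] and [- k] together contribute
   at least [2 a cos 1] to the real part of the partial sums at [x]. For
   4/N <= x <= 1/16 the frequencies up to [N] contain at least [N x / 2] such
   blocks, each with at least [1/(16 x)] elements, so the r-variation at [x] is
   at least a constant times [(N x)^(1/r) / (N x) = (N x)^(-1/r')], whereas
   [|f|_p] and [|f|_{p,1}] are of order [N^(-1/p)]. If [p < r'], already the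
   values on [1/32, 1/16] contradict boundedness as [N] grows; if [p = r'], the
   profile [x^(-1/p)] on [4/N, 1/16] makes the L^{p,s} quasi-norm larger by a
   factor [(ln N)^(1/s)]. *)

Require Import Defs.
From mathcomp Require Import all_boot all_order all_algebra.
From mathcomp.real_closed Require Import complex.
From mathcomp Require Import all_classical all_reals all_analysis.
From mathcomp Require Import measurable_realfun ring lra zify.
Import Order.TTheory GRing.Theory Num.Theory.
Import numFieldNormedType.Exports.
Local Open Scope ring_scope.

Set Implicit Arguments.
Unset Strict Implicit.
Unset Printing Implicit Defensive.

(** * The periodic pulse, its Fourier modes, and the variation of its partial sums *)

Section Pulse.
Variable R : realType.
Local Notation mu := (@lebesgue_measure R).
Implicit Types (a t x y : R) (l n m k : nat).

(** Removing [l] periods leaves an angle of modulus at most [2 pi / 8 < 1], and cosine is even and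
    decreasing on [0, pi]. *)
Lemma cos1_le_cos2pi t l : `|t - l%:R| <= 8^-1 -> cos 1 <= cos (2 * pi * t).
Proof.
move=> tl; pose s := 2 * pi * (t - l%:R).
have pi4 : (pi : R) < 4 by have := pihalf_lt2 R; lra.
have pi2 := pi_ge2 R.
have s1 : `|s| <= 1.
  rewrite /s !normrM (ger0_norm (pi_ge0 R)) ger0_norm//.
  have := ler_pM (normr_ge0 _) (pi_ge0 R) tl (ltW pi4); lra.
have -> : cos (2 * pi * t) = cos `|s|.
  rewrite cos_norm /s -[RHS](periodicn (@cosD2pi R) l); congr cos.
  by rewrite -[_ *+ l]mulr_natr -[pi *+ 2]mulr_natl; ring.
have [->//|s_neq1] := eqVneq `|s| 1.
by rewrite ltW// ltr_cos ?in_itv/= ?normr_ge0 ?lt_neqAle ?s_neq1//; lra.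
Qed.

(** Stated through the fractional part of [y], so that the indicator is 1-periodic on the whole
    line, as [measurable_torus_fun] demands. *)
Definition pulse_set a : set R :=
  [set y | 0 < y - (Num.floor y)%:~R < a]%classic.

Definition pulse a (y : R) : R[i] := (\1_(pulse_set a) y)%:C%C.

Lemma pulse_setE a y : a <= 1 -> y \in `[0, 1] -> pulse_set a y <-> y \in `]0, a[.
Proof.
(* The endpoint 1 is treated apart: its fractional part is 0, whereas [y < 1] has floor 0. *)
move=> a1; rewrite !in_itv/= => /andP[y0]; rewrite le_eqVlt => /orP[/eqP->|y1].
  have -> : pulse_set a 1 = (0 < (1 : R) - (Num.floor (1 : R))%:~R < a) by [].
  by rewrite floor1 subrr ltxx; split => // /andP[_]; rewrite ltNge a1.
have -> : pulse_set a y = (0 < y - (Num.floor y)%:~R < a) by [].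
by rewrite (@floor_def _ _ 0) ?subr0 ?y0 ?add0r.
Qed.

Lemma pulse_setI_itv a : a <= 1 ->
  (pulse_set a `&` `[0, 1] = `]0, a[)%classic.
Proof.
move=> a1; apply/seteqP; split => y /=.
  by move=> [ay y01]; apply/(pulse_setE a1).
move=> ya; have y01 : y \in `[0, 1].
  move: ya; rewrite !in_itv/= => /andP[/ltW-> /ltW/le_trans->]//.
by split => //; apply/(pulse_setE a1).
Qed.

Lemma measurable_pulse_set a :
  measurable (pulse_set a : set (measurableTypeR R)).
Proof.
(* The minimum keeps each piece within one period, [a] being arbitrary here. *)
have -> : pulse_set a =
    (\bigcup_(k : int) `](k%:~R : R), Num.min (k%:~R + 1) (k%:~R + a)[)%classic.
  apply/seteqP; split=> y /=.
    move=> /andP[y0 ya]; exists (Num.floor y) => //=.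
    rewrite in_itv/= lt_min; have /andP[_] := floor_itv y.
    rewrite intrD => ->; lra.
  move=> [k _] /=; rewrite in_itv/= lt_min => /and3P[ky yk ya].
  by rewrite /pulse_set/= (@floor_def _ _ k) ?intrD ?ltW ?yk//; lra.
apply: countable_bigcupT_measurable => [|k]; first exact: countableP.
exact: measurable_itv.
Qed.

Lemma measurable_torus_fun_pulse a : measurable_torus_fun (pulse a).
Proof.
split=> [y||].
- rewrite /pulse; congr (_ %:C)%C; rewrite !indicE; congr (_%:R).
  congr nat_of_bool; apply/idP/idP; rewrite !inE /pulse_set/=;
  rewrite (floorDrz y (_ : 1 \is a Num.int))// floor1 intrD; lra.
- rewrite /pulse/=; apply: measurable_indic; exact: measurable_pulse_set.
- exact: measurable_cst.
Qed.

Lemma integrable_pulseM a (F : R -> R) :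
  continuous F -> (forall y, `|F y| <= 1) ->
  mu.-integrable `[0, 1] (EFin \o (fun y => \1_(pulse_set a) y * F y)).
Proof.
move=> cF F1; apply: measurable_bounded_integrable.
- exact: measurable_itv.
- by rewrite /= lebesgue_measure_itv/= lte_fin ltr01 sube0 ltry.
- apply: measurable_funM.
    apply: measurable_indic; exact: measurable_pulse_set.
  apply: (measurable_funS measurableT) => //.
  exact: continuous_measurable_fun.
- exists 1; split; first exact: num_real.
  move=> M M1 y _ /=; rewrite normrM (le_trans _ (ltW M1))//.
  rewrite mulr_ile1// indicE normr_nat. by case: (_ \in _).
Qed.

(* The real part of [fhat_k * e(k x)] for the real function [pulse a]; it is even
   in [k], so natural frequencies suffice. *)
Definition pulse_mode a x k : R :=
  \int[mu]_(y in `[0, 1]) (\1_(pulse_set a) y * cos (2 * pi * (k%:R * (x - y)))).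

Lemma pulse_mode_ge a x k c : 0 <= a <= 1 -> 
  (forall y, 0 < y < a -> c <= cos (2 * pi * (k%:R * (x - y)))) ->
  c * a <= pulse_mode a x k.
Proof.
move=> /andP[a0 a1] ck.
have ia : mu.-integrable `[0, 1] (EFin \o (\1_(pulse_set a) : R -> R)).
  have -> : (\1_(pulse_set a) : R -> R) = (fun y => \1_(pulse_set a) y * cst 1 y).
    by apply/funext => y; rewrite mulr1.
  apply: integrable_pulseM => [|y]; last by rewrite normr1.
  exact: cst_continuous.
have <- : \int[mu]_(y in `[0, 1]) (c * \1_(pulse_set a) y) = c * a.
  rewrite RintegralZl//; congr (_ * _).
  rewrite /Rintegral integral_indic//; last exact: measurable_pulse_set.
  rewrite pulse_setI_itv//= lebesgue_measure_itv/= lte_fin.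
  by case: ltP => //= [_|/(conj a0)/andP/le_anti->]//; rewrite subr0.
apply: le_Rintegral => //.
- have := @integrableZl _ _ _ mu _ (measurable_itv _) c _ ia; apply.
- apply: integrable_pulseM => [y|y]; last exact: cos_max.
  apply: continuous_comp; last exact: continuous_cos.
  apply: cvgMl_tmp; apply: cvgMl_tmp; apply: cvgB => //; exact: cvg_cst.
move=> y y01; rewrite mulrC indicE; case: (boolP (y \in _)); last by rewrite !mul0r.
by rewrite inE pulse_setE// in_itv/= => /ck; rewrite !mul1r.
Qed.

(** The real part of the product is [cos cos - sin sin], which the addition formula merges under the
    integral; evenness of cosine then replaces [k] by its absolute value. *)
Lemma Re_fourier_term a x (k : int) :
  complex.Re (fourier_coef (pulse a) k * cis (2 * pi * k%:~R * x)) =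
  pulse_mode a x `|k|%N.
Proof.
have contm (c : R) : continuous (fun y : R => - (c * y)).
  by move=> y; apply: cvgN; apply: cvgMl_tmp; exact: cvg_id.
pose C y := \1_(pulse_set a) y * cos (- (2 * pi * k%:~R * y)).
pose S y := \1_(pulse_set a) y * sin (- (2 * pi * k%:~R * y)).
have iC : mu.-integrable `[0, 1] (EFin \o C).
  apply: integrable_pulseM => y; last exact: cos_max.
  by apply: continuous_comp; [exact: contm|exact: continuous_cos].
have iS : mu.-integrable `[0, 1] (EFin \o S).
  apply: integrable_pulseM => y; last exact: sin_max.
  by apply: continuous_comp; [exact: contm|exact: continuous_sin].
set u := 2 * pi * k%:~R * x.
transitivity (cos u * \int[mu]_(y in `[0, 1]) C y -
  sin u * \int[mu]_(y in `[0, 1]) S y).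
  rewrite /fourier_coef /cintegral01 /cis /= mulrC [X in _ - X]mulrC.
  by congr (_ * _ - _ * _); apply: eq_Rintegral => y _ /=; rewrite /C /S; ring.
rewrite -!RintegralZl// -RintegralB//; last 2 first.
- exact: (@integrableZl _ _ _ mu _ (measurable_itv _) (cos u) _ iC).
- exact: (@integrableZl _ _ _ mu _ (measurable_itv _) (sin u) _ iS).
apply: eq_Rintegral => y _; rewrite /C /S.
rewrite ![_ * (\1__ _ * _)]mulrCA -mulrBr -cosD; congr (_ * _).
have [k0|k0] := leP 0 k.
  by rewrite -[in LHS](gez0_abs k0) /u -[in LHS](gez0_abs k0) -!pmulrn; congr cos; ring.
rewrite -cosN /u -[k]opprK -(ltz0_abs k0) abszN absz_nat.
by rewrite mulrNz -!pmulrn; congr cos; ring.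
Qed.

(** The first and last indices of the longer sum are the frequencies [- n.+1] and [n.+1], whose
    modes agree; the indices in between are those of the shorter sum, shifted by one. *)
Lemma Re_fourier_sumS a x n :
  complex.Re (fourier_sum (pulse a) n.+1 x) =
  complex.Re (fourier_sum (pulse a) n x) + 2 * pulse_mode a x n.+1.
Proof.
have ReD (z w : R[i]) : complex.Re (z + w) = complex.Re z + complex.Re w.
  by case: z; case: w.
rewrite /fourier_sum doubleS big_ord_recl big_ord_recr/= !ReD !Re_fourier_term.
rewrite sub0r abszN absz_nat.
have -> : (bump 0 n.*2.+1)%:Z - n.+1%:Z = n.+1%:Z by rewrite /bump; lia.
rewrite absz_nat addrCA [2 * pulse_mode _ _ _]mulr_natl mulr2n; congr (_ + _).
congr complex.Re; apply: eq_bigr => i _.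
by have -> : (bump 0 i)%:Z - n.+1%:Z = i%:Z - n%:Z by rewrite /bump; lia.
Qed.

Lemma Re_fourier_sumB_ge a x m n c : (m <= n)%N ->
  (forall k, (m < k <= n)%N -> c <= 2 * pulse_mode a x k) ->
  (n - m)%:R * c <=
  complex.Re (fourier_sum (pulse a) n x - fourier_sum (pulse a) m x).
Proof.
move=> /subnKC <-; rewrite addKn.
have -> z w : complex.Re (z - w : R[i]) = complex.Re z - complex.Re w.
  by case: z; case: w.
elim: (n - m)%N => [|d IHd] hc; first by rewrite addn0 mul0r subrr.
rewrite addnS Re_fourier_sumS.
have {}IHd : d%:R * c <= complex.Re (fourier_sum (pulse a) (m + d) x) -
    complex.Re (fourier_sum (pulse a) m x).
  by apply: IHd => k hk; apply: hc; lia.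
have := hc (m + d).+1 ltac:(lia).
by rewrite -natr1 mulrDl mul1r; lra.
Qed.

(** * Frequency blocks and the pointwise lower bound for the variation *)

Lemma Re_le_cmod (z : R[i]) : complex.Re z <= cmod z.
Proof.
case: z => u v; rewrite /cmod /=; apply: (le_trans (ler_norm _)).
by rewrite -sqrtr_sqr ler_wsqrtr// lerDl sqr_ge0.
Qed.

(** The even terms will be the increments over the blocks near integers; the odd ones, over the gaps
    between blocks, are discarded. *)
Lemma sum_even_ge (v : nat -> R) D L :
  (forall j, 0 <= v j) -> (forall i, (i <= L)%N -> D <= v i.*2) ->
  L.+1%:R * D <= \sum_(0 <= j < L.*2.+1) v j.
Proof.
move=> v0; elim: L => [|L IHL] vD.
  by rewrite big_nat1 mul1r (vD 0%N).
rewrite doubleS 2?big_nat_recr//= -natr1 mulrDl mul1r -addrA lerD//.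
  by apply: IHL => i iL; apply: vD; lia.
by rewrite (le_trans (vD L.+1 _))// doubleS lerDr.
Qed.

(* The frequencies [k] in ]block_end x i.*2, block_end x i.*2.+1] are those for
   which [k * x] lies within 1/16 of the integer [i.+1]. *)
Definition block_end x j : nat :=
  Num.truncn ((j./2.+1%:R + (if odd j then 16^-1 else - 16^-1)) / x).

Lemma block_end_double x i :
  block_end x i.*2 = Num.truncn ((i.+1%:R - 16^-1) / x).
Proof. by rewrite /block_end odd_double doubleK. Qed.

Lemma block_end_doubleS x i :
  block_end x i.*2.+1 = Num.truncn ((i.+1%:R + 16^-1) / x).
Proof. by rewrite /block_end /= odd_double/= uphalf_double. Qed.

(** Truncation takes [v] to more than [v - 1] and does not increase [u]. *)
Lemma truncn_gap (u v : R) : 0 <= u -> u + 1 <= v ->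
  v - u - 1 < (Num.truncn v)%:R - (Num.truncn u)%:R :> R.
Proof.
move=> u0 uv; have v0 : 0 <= v by lra.
have /andP[] := truncn_itv u0; have /andP[] := truncn_itv v0.
by rewrite -![_.+1%:R]natr1; lra.
Qed.

Lemma ltn_truncn (u v : R) : 0 <= u -> u + 1 <= v ->
  (Num.truncn u < Num.truncn v)%N.
Proof. by move=> u0 uv; have := truncn_gap u0 uv; rewrite -(ltr_nat R); lra. Qed.

(** Before truncation, consecutive ends differ by [1/(8 x)] or [7/(8 x)], hence by at least 2 when
    [x <= 1/16]. *)
Lemma ltn_block_end x j : 0 < x <= 16^-1 -> (block_end x j < block_end x j.+1)%N.
Proof.
move=> /andP[x0 x16]; have X : 16 <= x^-1 by rewrite -lef_pV2 ?invrK ?posrE ?invr_gt0.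
rewrite -[j]odd_double_half; set q := j./2.
have q0 : 0 <= q%:R :> R by [].
case: (odd j) => /=; rewrite ?add0n ?add1n.
  rewrite -doubleS block_end_double block_end_doubleS.
  apply: ltn_truncn; rewrite -[q.+1%:R]natr1; first by apply: divr_ge0; lra.
  by rewrite -[q.+2%:R]natr1 -[q.+1%:R]natr1; nra.
rewrite block_end_double block_end_doubleS.
apply: ltn_truncn; rewrite -[q.+1%:R]natr1; first by apply: divr_ge0; lra.
by nra.
Qed.

(** The block has at least [1/(16 x)] frequencies, each contributing at least [2 a cos 1] with
    [a = 1/(16 N)]. The condition [i.+2 <= N x] keeps these frequencies at most [N]. *)
Lemma pulse_block_ge (N : nat) x i : 0 < x <= 16^-1 -> i.+2%:R <= N%:R * x ->
  cos 1 / 128 / (N%:R * x) <=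
  cmod (fourier_sum (pulse (16 * N%:R)^-1) (block_end x i.*2.+1) x -
        fourier_sum (pulse (16 * N%:R)^-1) (block_end x i.*2) x).
Proof.
move=> x016 iN; have /andP[x0 x16] := x016.
have N0 : 0 < N%:R :> R.
  have i0 : 0 <= i%:R :> R by [].
  by move: iN; rewrite -[i.+2%:R]natr1 -[i.+1%:R]natr1; nra.
have N1 : 1 <= N%:R :> R by move: N0; rewrite ltr0n ler1n.
set a := (16 * N%:R)^-1; have a0 : 0 < a by rewrite invr_gt0 mulr_gt0.
have Na : N%:R * a = 16^-1 by rewrite /a invfM mulrCA divff ?gt_eqF// mulr1.
have a1 : a <= 1 by nra.
apply: le_trans (Re_le_cmod _).
apply: le_trans (Re_fourier_sumB_ge (c := 2 * (cos 1 * a)) _ _).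
- rewrite block_end_double block_end_doubleS natrB; last first.
    by rewrite -block_end_double -block_end_doubleS ltnW// ltn_block_end.
  have X : 16 <= x^-1 by rewrite -lef_pV2 ?invrK ?posrE ?invr_gt0.
  have i0 : 0 <= i%:R :> R by [].
  have := @truncn_gap ((i.+1%:R - 16^-1) / x) ((i.+1%:R + 16^-1) / x).
  rewrite -[i.+1%:R]natr1 => gap.
  have {}gap := gap ltac:(apply: divr_ge0; lra) ltac:(nra).
  (* Before rounding the block has length [1/(8 x)]; since [1/x >= 16], a loss of 1 still leaves
     [1/(16 x)]. *)
  have {}gap : 16^-1 / x <= (Num.truncn ((i%:R + 1 + 16^-1) / x))%:R - 
    (Num.truncn ((i%:R + 1 - 16^-1) / x))%:R by apply: le_trans (ltW gap); nra.
  have c0 := cos1_gt0 R.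
  have -> : cos 1 / 128 / (N%:R * x) = 16^-1 / x * (2 * (cos 1 * a)).
    by rewrite /a; field; lra.
  rewrite ler_wpM2r//; nra.
- by rewrite ltnW// ltn_block_end.
move=> k /andP[mk kn]; rewrite ler_pM2l//.
apply: pulse_mode_ge => [|y /andP[y0 ya]]; first by rewrite ltW.
(* [k x] is within 1/16 of [i.+1] and [0 <= k y <= N a = 1/16], so [k (x - y)] is within 1/8. *)
apply: (cos1_le_cos2pi (l := i.+1)).
have i0 : 0 <= i%:R :> R by [].
have kx_ub : k%:R * x <= i.+1%:R + 16^-1.
  rewrite -ler_pdivlMr// -truncn_ge_nat -?block_end_doubleS//.
  by rewrite -[i.+1%:R]natr1; apply: divr_ge0; lra.
have kx_lb : i.+1%:R - 16^-1 <= k%:R * x.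
  rewrite -ler_pdivrMr// ltW//.
  rewrite -truncn_lt_nat -?block_end_double//.
  by rewrite -[i.+1%:R]natr1; apply: divr_ge0; lra.
have kN : k%:R <= N%:R :> R.
  rewrite -(ler_pM2r x0) (le_trans kx_ub)// (le_trans _ iN)//.
  by rewrite -[i.+2%:R]natr1; lra.
have k0 : 0 <= k%:R :> R by [].
have ky : k%:R * y <= 16^-1 by rewrite -Na ler_pM// ltW.
have ky0 : 0 <= k%:R * y by rewrite mulr_ge0// ltW.
by rewrite mulrBr ler_norml; lra.
Qed.

Lemma fourier_variation_pulse_ge (r : R) (N : nat) x : 0 < r ->
  4 <= N%:R * x -> 0 < x <= 16^-1 ->
  ((cos 1 / 128 * 2^-1 `^ r^-1 * (N%:R * x) `^ (r^-1 - 1))%:E <=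
   fourier_variation r (pulse (16 * N%:R)^-1) x)%E.
Proof.
move=> r0 Nx4 x016; have /andP[x0 x16] := x016.
set w := N%:R * x in Nx4 *.
have w0 : 0 < w by lra.
(* The blocks [i <= L] are those with [i.+2 <= w]; as [w >= 4], their number [L.+1 > w - 2] is at
   least [w / 2]. *)
pose L := (Num.truncn w - 2)%N.
have Lw : L.+2%:R <= w /\ w / 2 <= L.+1%:R.
  have /andP[] := truncn_itv (ltW w0).
  have T4 : (4 <= Num.truncn w)%N by rewrite truncn_ge_nat// ltW.
  have -> : Num.truncn w = L.+2 by rewrite /L; lia.
  by rewrite -[L.+3%:R]natr1 -[L.+2%:R]natr1 -[L.+1%:R]natr1; split; lra.
case: Lw => L2 L1.
set c := cos 1 / 128.
have c0 : 0 < c by have := cos1_gt0 R; rewrite /c; lra.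
pose D := c / w.
have D0 : 0 <= D by rewrite divr_ge0// ltW.
(* These [K] increments alternate between [L.+1] blocks and the [L] gaps separating them. *)
pose K := L.*2.+1; pose f := pulse (16 * N%:R)^-1.
pose u l := cmod (fourier_sum f (block_end x l) x -
                  fourier_sum f (block_end x l.-1) x) `^ r.
apply: (@le_trans _ _ ((\sum_(1 <= l < K.+1) u l) `^ r^-1)%:E); last first.
  apply: ereal_sup_ubound.
  by exists K, (block_end x); split => // l _; exact: ltn_block_end.
rewrite lee_fin.
have sumge : L.+1%:R * D `^ r <= \sum_(1 <= l < K.+1) u l.
  rewrite big_add1/=; apply: sum_even_ge => [j|i iL]; first exact: powR_ge0.
  rewrite /u /= ge0_ler_powR ?nnegrE ?(ltW r0)//.
    by rewrite /cmod /ComplexField.Normc.normc; case: (_ - _) => ? ?; exact: sqrtr_ge0.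
  apply: pulse_block_ge => //; apply: le_trans L2.
  by rewrite ler_nat; lia.
apply: (@le_trans _ _ ((w / 2 * D `^ r) `^ r^-1)); last first.
  rewrite ge0_ler_powR ?nnegrE ?invr_ge0 ?(ltW r0)//.
  - by rewrite mulr_ge0 ?powR_ge0// divr_ge0// ltW.
  - by apply: sumr_ge0 => *; exact: powR_ge0.
  - by apply: le_trans sumge; rewrite ler_wpM2r// powR_ge0.
rewrite powRM ?powR_ge0// ?divr_ge0 ?(ltW w0)//.
rewrite -powRrM divff ?gt_eqF// powRr1// powRM ?(ltW w0)// ?invr_ge0//.
rewrite powRB; last by rewrite (gt_eqF w0) implybT.
rewrite powRr1 ?(ltW w0)// /D; set z := w `^ _; set z2 := 2^-1 `^ _.
by rewrite le_eqVlt; apply/orP; left; apply/eqP; field; lra.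
Qed.

End Pulse.

(** * Comparison of integrals and explicit integrals of powers *)

Section Integrals.
Variable R : realType.
Local Notation mu := (@lebesgue_measure R).

(** The integral of a nonnegative function is a supremum over the simple functions below it, hence
    monotone. This allows comparisons involving the variation and the rearrangement without a proof
    of their measurability. *)
Lemma ge0_le_integral_patch d (T : measurableType d)
    (nu : {measure set T -> \bar R}) (D1 D2 : set T) (f1 f2 : T -> \bar R) :
  (forall x, D1 x -> 0 <= f1 x)%E -> (forall x, D2 x -> 0 <= f2 x)%E ->
  (forall x, (f1 \_ D1) x <= (f2 \_ D2) x)%E ->
  (\int[nu]_(x in D1) f1 x <= \int[nu]_(x in D2) f2 x)%E.
Proof.
move=> f10 f20 f12; rewrite !ge0_integralE//; apply: ereal_sup_le.
by move=> _ [h /= hf1 <-]; exists h => // x; exact: le_trans (f12 x).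
Qed.

Lemma ge0_le_integral_subset d (T : measurableType d)
    (nu : {measure set T -> \bar R}) (D1 D2 : set T) (f1 f2 : T -> \bar R) :
  (D1 `<=` D2)%classic ->
  (forall x, D1 x -> 0 <= f1 x)%E -> (forall x, D2 x -> 0 <= f2 x)%E ->
  (forall x, D1 x -> f1 x <= f2 x)%E ->
  (\int[nu]_(x in D1) f1 x <= \int[nu]_(x in D2) f2 x)%E.
Proof.
move=> D12 f10 f20 f12; apply: ge0_le_integral_patch => // x.
rewrite /patch; case: ifPn => [|_].
  rewrite inE => xD; rewrite mem_set; [exact: f12|exact: D12].
by change (0 <= (if x \in D2 then f2 x else 0))%E; case: ifPn; rewrite // inE => /f20.
Qed.

(* [lebesgue_measure] is defined on all sets, as the outer measure. *)
Lemma le_torus_measure (A B : set R) :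
  (A `<=` B)%classic -> (torus_measure R A <= torus_measure R B)%E.
Proof.
move=> AB; rewrite /torus_measure /= /mrestr.
rewrite /lebesgue_measure /lebesgue_stieltjes_measure /measure_extension.
by apply: le_outer_measure; exact: setSI.
Qed.

Lemma torus_measure_itv (u v : R) : 0 <= u -> u <= v -> v <= 1 ->
  torus_measure R `[u, v]%classic = (v - u)%:E.
Proof.
move=> u0 uv v1; rewrite /torus_measure /= /mrestr setIidl; last first.
  by move=> x /=; rewrite !in_itv/= => /andP[ux xv]; apply/andP; lra.
rewrite lebesgue_measure_itv/= lte_fin.
case: ltP => [_|vu]; first by rewrite EFinB.
have -> : v = u by lra.
by rewrite subrr.
Qed.

Lemma Lnorm_ge_itv (p b u v : R) (g : R -> \bar R) : 0 < p -> 0 <= b ->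
  0 <= u -> u <= v -> v <= 1 ->
  (forall x, u <= x <= v -> (b%:E <= g x)%E) ->
  ((b * (v - u) `^ p^-1)%:E <= 'N[torus_measure R]_(p%:E) [g])%E.
Proof.
move=> p0 b0 u0 uv v1 bg; rewrite unlock.
have -> : b * (v - u) `^ p^-1 = (b `^ p * (v - u)) `^ p^-1.
  by rewrite powRM ?powR_ge0 ?subr_ge0// -powRrM divff ?gt_eqF// powRr1.
rewrite -poweR_EFin; apply: gt0_ler_poweR.
- by rewrite invr_ge0 ltW.
- by rewrite in_itv/= leey lee_fin mulr_ge0 ?powR_ge0// subr_ge0.
- by rewrite in_itv/= leey integral_ge0// => x _; exact: poweR_ge0.
have <- : (\int[torus_measure R]_(x in `[u, v]) (cst (b `^ p)%:E) x)%E =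
    (b `^ p * (v - u))%:E.
  by rewrite integral_cst//= torus_measure_itv.
apply: ge0_le_integral_subset => // [x _|x _|x]; rewrite ?lee_fin ?powR_ge0 ?poweR_ge0//.
rewrite /= in_itv/= => /bg bgx; rewrite -poweR_EFin.
apply: gt0_ler_poweR; rewrite ?in_itv/= ?leey ?(ltW p0) ?lee_fin ?b0 ?abse_ge0//.
by rewrite (le_trans bgx)// lee_abs.
Qed.

(** The fundamental theorem in a form serving both [t^(e - 1)] and [1/t]: derivability of [f]
    supplies its continuity, that of [F] the continuity at the endpoints. *)
Lemma FTC2_pos (F f : R -> R) (u v : R) : 0 < u -> u < v ->
  (forall t : R, 0 < t -> derivable f t 1) ->
  (forall t : R, 0 < t -> is_derive t 1 F (f t)) ->
  (\int[mu]_(t in `[u, v]) (f t)%:E = (F v)%:E - (F u)%:E)%E.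
Proof.
move=> u0 uv df dF.
have cF (t : R) : 0 < t -> {for t, continuous F}.
  move=> t0; apply: differentiable_continuous; apply/derivable1_diffP.
  by have [] := dF _ t0.
apply: continuous_FTC2 => //.
- apply: derivable_within_continuous => t; rewrite in_itv/= => /andP[ut _].
  exact: df (lt_le_trans u0 ut).
- split.
  + move=> t; rewrite in_itv/= => /andP[ut _].
    by have [] := dF _ (lt_trans u0 ut).
  + apply: cvg_at_right_filter; exact: cF.
  + apply: cvg_at_left_filter; exact: cF (lt_trans u0 uv).
- move=> t; rewrite in_itv/= => /andP[ut _].
  have := dF _ (lt_trans u0 ut) => D.
  by rewrite derive1E derive_val.
Qed.

(** The integrand may be singular at 0, so ]0, a] is exhausted by compact intervals; on each, the
    nonnegative value of the antiderivative at the left end is dropped. *)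
Lemma integral_powR_le (e a : R) : 0 < e -> 0 < a ->
  (\int[mu]_(t in `]0%R, a]) (t `^ (e - 1))%:E <= (a `^ e / e)%:E)%E.
Proof.
move=> e0 a0.
(* With [n.+2] the left end stays strictly below [a], as [FTC2_pos] requires. *)
pose F n := (`[a / n.+2%:R, a])%classic : set R.
have a2 n : 0 < a / n.+2%:R < a.
  by rewrite divr_gt0//= gtr_pMr// invf_lt1// ltr1n.
have UF : (`]0, a])%classic = (\bigcup_n F n)%classic.
  apply/seteqP; split => t; rewrite /F /= ?in_itv/=.
    move=> /andP[t0 ta]; exists (Num.bound (a / t)) => //=.
    rewrite in_itv/= ta andbT ler_pdivrMr// mulrC -ler_pdivrMr//.
    have /ltW/le_trans-> // := archi_boundP (ltW (divr_gt0 a0 t0)).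
    by rewrite ler_nat; do 2!apply: leqW.
  move=> [n _]; rewrite /= in_itv/= => /andP[nt ->]; rewrite andbT.
  by apply: lt_le_trans nt; case/andP: (a2 n).
have mf : measurable_fun setT (fun t : R => (t `^ (e - 1))%:E).
  by apply/measurable_EFinP; exact: measurable_powR.
rewrite UF.
have df (t : R) : 0 < t -> derivable (fun t : R => t `^ (e - 1)) t 1.
  by move=> /(is_derive1_powR (e - 1))[].
have dF (t : R) : 0 < t -> is_derive t 1 (fun t : R => t `^ e / e) (t `^ (e - 1)).
  move=> t0; have D := is_derive1_powR e t0.
  have := @is_deriveZ _ _ _ _ e^-1 _ _ _ D.
  rewrite [_ *: _](_ : _ = t `^ (e - 1)); last first.
    by rewrite /GRing.scale/=; field; lra.
  by congr is_derive; apply/funext => z; exact: mulrC.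
have H := @ge0_nondecreasing_set_cvg_integral _ (measurableTypeR R) R F
  (fun t : R => (t `^ (e - 1))%:E) mu.
apply: (cvge_le _ (H _ _ _ _)).
- near=> n; case/andP: (a2 n) => an0 ana.
  rewrite (FTC2_pos an0 ana df dF).
  by rewrite -EFinB lee_fin gerBl divr_ge0 ?powR_ge0// ltW.
- move=> m n mn; rewrite subsetEset => t; rewrite /F/= !in_itv/= => /andP[mt ->].
  rewrite andbT (le_trans _ mt)// ler_pM2l// lef_pV2 ?posrE// ler_nat; lia.
- by move=> n; exact: measurable_itv.
- by move=> n; apply: measurable_funTS.
- by move=> n t _; rewrite lee_fin powR_ge0.
Unshelve. all: by end_near.
Qed.

Lemma integral_inv_itv (u v : R) : 0 < u -> u < v ->
  (\int[mu]_(t in `[u, v]) (t^-1)%:E = (ln v - ln u)%:E)%E.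
Proof.
move=> u0 uv.
have df (t : R) : 0 < t -> derivable (fun t : R => t^-1) t 1.
  by move=> t0; apply: derivableV; rewrite ?gt_eqF//; exact: derivable_id.
have dF (t : R) : 0 < t -> is_derive t 1 (@ln R) t^-1 by exact: is_derive1_ln.
by rewrite (FTC2_pos u0 uv df dF) EFinB.
Qed.
End Integrals.

(** * Lebesgue and Lorentz norms: values and upper bounds for pulses, lower bounds for power
    profiles *)

Section Norms.
Variable R : realType.
Local Notation mu := (@lebesgue_measure R).
Local Notation nu := (torus_measure R).

Lemma torus_measure_pulse_set (a : R) : 0 <= a <= 1 -> nu (pulse_set a) = a%:E.
Proof.
move=> /andP[a0 a1]; rewrite /torus_measure /= /mrestr pulse_setI_itv//.
rewrite lebesgue_measure_itv/= lte_fin.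
by case: ltP => [_|/(conj a0)/andP/le_anti<-]; rewrite ?sube0.
Qed.

Lemma abs_fun_pulse (a : R) : abs_fun (pulse a) = EFin \o \1_(pulse_set a).
Proof.
apply/funext => x; congr (_%:E).
by rewrite /cmod /pulse /= expr0n addr0 sqrtr_sqr ger0_norm.
Qed.

Lemma Lnorm_pulse (a p : R) : 0 <= a <= 1 -> 0 < p ->
  ('N[nu]_(p%:E) [abs_fun (pulse a)] = (a `^ p^-1)%:E)%E.
Proof.
move=> a01 p0; rewrite unlock abs_fun_pulse.
under eq_integral => x _.
  have -> : ((`|(EFin \o \1_(pulse_set a)) x| `^ p) = (\1_(pulse_set a) x)%:E)%E.
    rewrite -[LHS]/((`|\1_(pulse_set a) x|%R%:E `^ p)%E) poweR_EFin.
    rewrite indicE normr_nat; case: (_ \in _).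
      by rewrite powR1.
    by rewrite powR0// gt_eqF.
  over.
rewrite integral_indic//=; last exact: measurable_pulse_set.
by rewrite setIT torus_measure_pulse_set// poweR_EFin.
Qed.

Lemma in_Lp_pulse (a p : R) : 0 <= a <= 1 -> 0 < p -> in_Lp p (pulse a).
Proof.
move=> a01 p0; split; first exact: measurable_torus_fun_pulse.
by rewrite Lnorm_pulse// ltry.
Qed.

Lemma decreasing_rearrangement_ge0 (g : R -> \bar R) t :
  (0 <= decreasing_rearrangement nu g t)%E.
Proof. by apply: le_ereal_inf_tmp => _ [s [s0 _] <-]; rewrite lee_fin. Qed.

Lemma decreasing_rearrangement_pulse_le1 (a t : R) : 0 <= t ->
  (decreasing_rearrangement nu (abs_fun (pulse a)) t <= 1)%E.
Proof.
move=> t0; apply: ereal_inf_lbound; exists 1 => //; split => //.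
rewrite /distribution_function abs_fun_pulse.
rewrite (_ : [set x | _]%classic = set0) ?measure0 ?lee_fin//.
apply/seteqP; split => x //=.
by rewrite lte_fin indicE normr_nat; case: (_ \in _); rewrite ?ltxx// ltNge ler01.
Qed.

Lemma decreasing_rearrangement_pulse_eq0 (a t : R) : 0 <= a <= 1 -> a <= t ->
  decreasing_rearrangement nu (abs_fun (pulse a)) t = 0%E.
Proof.
move=> a01 at_; apply/eqP; rewrite eq_le decreasing_rearrangement_ge0 andbT.
apply: ereal_inf_lbound; exists 0 => //; split => //.
rewrite /distribution_function abs_fun_pulse (_ : [set x | _]%classic = pulse_set a).
  by rewrite torus_measure_pulse_set// lee_fin.
apply/seteqP; split => x /=; rewrite lte_fin indicE normr_nat.
  by case: (boolP (_ \in _)); rewrite ?ltxx// inE.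
by move=> xa; rewrite mem_set.
Qed.

(** The rearrangement is at most 1 and vanishes from [a] on, so the integrand is dominated by
    [t^(1/p - 1)] on ]0, a]. *)
Lemma lorentz_norm_pulse_le (a p : R) : 0 < a <= 1 -> 0 < p ->
  (lorentz_norm nu p 1 (abs_fun (pulse a)) <= (p * a `^ p^-1)%:E)%E.
Proof.
move=> /andP[a0 a1] p0; have a01 : 0 <= a <= 1 by rewrite ltW.
have F0 t : 0 < t ->
    (0 <= (t `^ p^-1)%:E * decreasing_rearrangement nu (abs_fun (pulse a)) t)%E.
  by move=> t0; rewrite mule_ge0 ?lee_fin ?powR_ge0// decreasing_rearrangement_ge0.
rewrite /lorentz_norm invr1 poweRe1; last first.
  apply: integral_ge0 => t; rewrite /= in_itv/= andbT => t0.
  by rewrite mule_ge0 ?poweR_ge0// lee_fin invr_ge0 ltW.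
have -> : p * a `^ p^-1 = a `^ p^-1 / p^-1 by rewrite invrK mulrC.
apply: le_trans (integral_powR_le _ a0); last by rewrite invr_gt0.
apply: ge0_le_integral_patch => t.
- rewrite /= in_itv/= andbT => t0.
  by rewrite mule_ge0 ?poweR_ge0// lee_fin invr_ge0 ltW.
- by rewrite lee_fin powR_ge0.
rewrite /patch; case: ifPn => [|t0]; last first.
  rewrite memNset// => ta; move: t0; rewrite notin_setE => -[]//.
  by move: ta; rewrite /= !in_itv/= => /andP[->].
rewrite inE/= in_itv/= andbT => t0; rewrite poweRe1 ?F0//.
have ti : 0 <= t^-1 by rewrite invr_ge0 ltW.
have [ta|ta] := leP t a.
  rewrite mem_set/= ?in_itv/= ?t0//.
  rewrite powRB; last by rewrite (gt_eqF t0) implybT.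
  rewrite powRr1 ?(ltW t0)// EFinM.
  apply: lee_pmul; rewrite ?F0 ?lee_fin// -[leRHS]mule1.
  apply: lee_pmul; rewrite ?decreasing_rearrangement_ge0 ?lee_fin ?powR_ge0//.
  exact: decreasing_rearrangement_pulse_le1 (ltW t0).
rewrite decreasing_rearrangement_pulse_eq0 ?(ltW ta)// mule0 mul0e.
by rewrite memNset//= in_itv/= => /andP[_]; rewrite leNgt ta.
Qed.

Lemma in_Lorentz_pulse (a p : R) : 0 < a <= 1 -> 0 < p ->
  in_Lorentz p 1 (pulse a).
Proof.
move=> a01 p0; split; first exact: measurable_torus_fun_pulse.
by rewrite (le_lt_trans (lorentz_norm_pulse_le a01 p0))// ltry.
Qed.

(** For [s < b] the superlevel set at [s] contains [u, 2t], whose measure [2 t - u] exceeds [t]; so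
    no such [s] competes in the infimum. *)
Lemma decreasing_rearrangement_ge (g : R -> \bar R) (b u t : R) :
  0 <= u -> 2 * u <= t -> 0 < t -> 2 * t <= 1 ->
  (forall x, u <= x <= 2 * t -> (b%:E <= g x)%E) ->
  (b%:E <= decreasing_rearrangement nu g t)%E.
Proof.
move=> u0 ut t0 t1 bg; apply: le_ereal_inf_tmp => _ [s [s0 ds] <-].
rewrite lee_fin leNgt; apply/negP => sb; move: ds; apply/negP; rewrite -ltNge.
apply: (@lt_le_trans _ _ (nu `[u, 2 * t]%classic)).
  by rewrite torus_measure_itv ?lte_fin//; lra.
apply: le_torus_measure => x; rewrite /= in_itv/= => /bg bgx.
by rewrite (lt_le_trans _ (lee_abs _))// (lt_le_trans _ bgx)// lte_fin.
Qed.

(** For [2 u <= t <= v / 2] the rearrangement at [t] is at least [b (2 t)^(-1/p)], so the integrand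
    is at least a constant over [t]. The logarithm is the integral of [1/t] over this range. *)
Lemma lorentz_norm_ge (g : R -> \bar R) (p s b u v : R) :
  0 < p -> 0 < s -> 0 <= b -> 0 < u -> 4 * u < v -> v <= 1 ->
  (forall x, u <= x <= v -> ((b * x `^ (- p^-1))%:E <= g x)%E) ->
  ((b * 2 `^ (- p^-1) * (ln (v / (4 * u))) `^ s^-1)%:E <= lorentz_norm nu p s g)%E.
Proof.
move=> p0 s0 b0 u0 uv v1 bg.
set B := b * 2 `^ (- p^-1); set L := ln _.
have v0 : 0 < v by lra.
have L0 : 0 <= L by rewrite ln_ge0// ler_pdivlMr ?mul1r//; lra.
have B0 : 0 <= B by rewrite mulr_ge0 ?powR_ge0.
have -> : B * (L `^ s^-1) = (B `^ s * L) `^ s^-1.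
  by rewrite powRM ?powR_ge0// -powRrM divff ?gt_eqF// powRr1.
have F0 t : (`]0, +oo[)%classic t ->
    (0 <= ((t `^ p^-1)%:E * decreasing_rearrangement nu g t) `^ s * (t^-1)%:E)%E.
  by rewrite /= in_itv/= andbT => t0; rewrite mule_ge0 ?poweR_ge0// lee_fin invr_ge0 ltW.
rewrite -poweR_EFin; apply: gt0_ler_poweR.
- by rewrite invr_ge0 ltW.
- by rewrite in_itv/= leey lee_fin mulr_ge0 ?powR_ge0.
- by rewrite in_itv/= leey integral_ge0.
have u2v : 2 * u < v / 2 by lra.
have -> : ((B `^ s * L)%:E =
    \int[mu]_(t in `[(2 * u)%R, (v / 2)%R]) ((B `^ s)%:E * (t^-1)%:E))%E.
  rewrite ge0_integralZl//=.
  - rewrite integral_inv_itv//; last lra.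
    rewrite -EFinM; congr (_ * _)%:E.
    rewrite -ln_div ?posrE; [|lra..].
    by congr ln; field; lra.
  - apply/measurable_EFinP; apply: subspace_continuous_measurable_fun => //.
    apply: derivable_within_continuous => t; rewrite in_itv/= => /andP[ut _].
    by apply: derivableV; [rewrite gt_eqF//; lra|exact: derivable_id].
  - by move=> t; rewrite in_itv/= => /andP[ut _]; rewrite lee_fin invr_ge0; lra.
  - by rewrite lee_fin powR_ge0.
apply: ge0_le_integral_subset => //.
- by move=> t; rewrite /= !in_itv/= => /andP[ut _]; rewrite andbT; lra.
- move=> t; rewrite /= in_itv/= => /andP[ut _].
  by rewrite -EFinM lee_fin mulr_ge0 ?powR_ge0// invr_ge0; lra.
move=> t; rewrite /= in_itv/= => /andP[ut tv].
have t0 : 0 < t by lra.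
apply: lee_pmul; rewrite ?lee_fin ?powR_ge0 ?invr_ge0 ?(ltW t0)//.
have tB : (B%:E <= (t `^ p^-1)%:E * decreasing_rearrangement nu g t)%E.
  have -> : B = t `^ p^-1 * (b * (2 * t) `^ (- p^-1)).
    rewrite powRM ?(ltW t0)// mulrCA; congr (_ * _).
    rewrite mulrCA -powRD ?addrN ?powRr0 ?mulr1//.
    by rewrite (gt_eqF t0) implybT.
  rewrite EFinM lee_pmul ?lee_fin ?powR_ge0//.
    by rewrite mulr_ge0 ?powR_ge0.
  (* The profile decreases, so on [u, 2t] it is smallest at [2 t]. *)
  apply: (@decreasing_rearrangement_ge _ _ u) => //; [lra..|].
  move=> x /andP[ux xt]; apply: le_trans (bg x _); last by rewrite ux; lra.
  rewrite lee_fin ler_wpM2l// !powRN lef_pV2 ?posrE ?powR_gt0//; [|lra..].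
  by rewrite ge0_ler_powR ?nnegrE ?invr_ge0 ?(ltW p0)//; lra.
rewrite -poweR_EFin; apply: gt0_ler_poweR => //.
- by rewrite ltW.
- by rewrite in_itv/= leey lee_fin B0.
- by rewrite in_itv/= leey (le_trans _ tB).
Qed.

End Norms.

(** * Letting [N] grow: failure of both inequalities *)

Section Unbounded.
Variable R : realType.
Local Notation nu := (torus_measure R).

Lemma exists_nat_powR_gt (e M : R) m : 0 < e ->
  exists2 N : nat, (m <= N)%N & M < N%:R `^ e.
Proof.
move=> e0; exists (m + Num.bound (`|M| `^ e^-1))%N; first exact: leq_addr.
apply: le_lt_trans (ler_norm _) _.
rewrite [ltLHS](_ : _ = (`|M| `^ e^-1) `^ e); last first.
  by rewrite -powRrM mulVf ?gt_eqF// powRr1.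
rewrite gt0_ltr_powR ?nnegrE ?powR_ge0//.
apply: lt_le_trans (archi_boundP (powR_ge0 `|M| e^-1)) _.
by rewrite ler_nat leq_addl.
Qed.

(** Hides the explicit constant, keeping only that it is positive and independent of [N] and [x]. *)
Lemma fourier_variation_pulse_lb (r : R) : 0 < r -> exists2 K : R, 0 < K &
  forall (N : nat) x, 4 <= N%:R * x -> 0 < x <= 16^-1 ->
  ((K * (N%:R * x) `^ (r^-1 - 1))%:E <=
   fourier_variation r (pulse (16 * N%:R)^-1) x)%E.
Proof.
move=> r0; exists (cos 1 / 128 * 2^-1 `^ r^-1).
  by rewrite mulr_gt0 ?powR_gt0 ?divr_gt0 ?cos1_gt0.
by move=> N x; exact: fourier_variation_pulse_ge.
Qed.

Lemma fourier_variation_unbounded_Lp (r p : R) : 2 < r -> 1 <= p -> p < r / (r - 1) ->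
  ~ (exists C : R, forall f : R -> R[i], in_Lp p f ->
      ('N[nu]_(p%:E) [fourier_variation r f]
         <= C%:E * 'N[nu]_(p%:E) [abs_fun f])%E).
Proof.
move=> r2; have r0 : 0 < r by lra.
have [K K0 VK] := fourier_variation_pulse_lb r0.
move=> p1; rewrite ltr_pdivlMr; last lra.
move=> pr [C HC]; have p0 : 0 < p by lra.
(* [q] is [1/r'], and [e > 0] amounts to [p < r']. *)
pose q := 1 - r^-1; pose e := p^-1 - q.
have q0 : 0 <= q by rewrite subr_ge0 invf_le1//; lra.
have e0 : 0 < e.
  have -> : e = (r - p * (r - 1)) / (p * r) by rewrite /e /q; field; lra.
  by rewrite divr_gt0 ?subr_gt0// mulr_gt0.
pose A := K * (16^-1 `^ (- q) * 32^-1 `^ p^-1).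
have A0 : 0 < A by rewrite !mulr_gt0 ?powR_gt0.
(* The two sides become [A N^(-q)] and [A M N^(-1/p)], so [N^e > M] is a contradiction. Taking
   [N >= 128] gives [4 <= N x] for [x >= 1/32]. *)
pose M := C * 16^-1 `^ p^-1 / A.
have [N N128 MN] := exists_nat_powR_gt M 128 e0.
have N0 : 0 < N%:R :> R by rewrite ltr0n; lia.
have {}N128 : 128 <= N%:R :> R by rewrite ler_nat.
have a01 : 0 <= (16 * N%:R : R)^-1 <= 1.
  by rewrite invr_ge0 invf_le1; [|lra]; apply/andP; split; lra.
have := HC _ (in_Lp_pulse a01 p0); rewrite Lnorm_pulse//; apply/negP; rewrite -ltNge.
apply: (@lt_le_trans _ _ (K * (N%:R / 16) `^ (- q) * (16^-1 - 32^-1) `^ p^-1)%:E).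
  rewrite -EFinM lte_fin.
  have -> : 16^-1 - 32^-1 = 32^-1 :> R by lra.
  have -> : K * (N%:R / 16) `^ (- q) * 32^-1 `^ p^-1 = A * N%:R `^ (- q).
    by rewrite powRM ?(ltW N0)// /A; ring.
  rewrite invfM powRM ?invr_ge0 ?(ltW N0)// mulrA.
  have -> : C * 16^-1 `^ p^-1 = A * M by rewrite /M; field; lra.
  rewrite -mulrA ltr_pM2l//.
  have -> : N%:R^-1 `^ p^-1 = N%:R `^ (- p^-1) :> R.
    by rewrite -powR_inv1 ?(ltW N0)// -powRrM mulN1r.
  rewrite -(ltr_pM2r (powR_gt0 p^-1 N0)) -mulrA -!powRD ?(gt_eqF N0) ?implybT//.
  by rewrite addNr powRr0 mulr1 addrC.
apply: Lnorm_ge_itv; [lra|by rewrite mulr_ge0 ?powR_ge0 ?ltW|lra..|].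
move=> x /andP[x32 x16].
apply: le_trans (VK N _ _ _); [|nra|lra].
rewrite lee_fin ler_pM2l// (_ : r^-1 - 1 = - q); last by rewrite /q; ring.
have Nx0 : 0 < N%:R * x by rewrite mulr_gt0//; lra.
rewrite !powRN lef_pV2 ?posrE ?powR_gt0 ?divr_gt0//.
by rewrite ge0_ler_powR ?nnegrE ?(ltW Nx0) ?divr_ge0 ?(ltW N0)//; nra.
Qed.

Lemma fourier_variation_unbounded_Lorentz (r s : R) : 2 < r -> 1 <= s ->
  ~ (exists C : R, forall f : R -> R[i], in_Lorentz (r / (r - 1)) 1 f ->
      (lorentz_norm nu (r / (r - 1)) s (fourier_variation r f)
         <= C%:E * lorentz_norm nu (r / (r - 1)) 1 (abs_fun f))%E).
Proof.
move=> r2; have r0 : 0 < r by lra.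
have [K K0 VK] := fourier_variation_pulse_lb r0.
move=> s1 [C HC]; set p := r / (r - 1) in HC.
have s0 : 0 < s by lra.
have p0 : 0 < p by rewrite divr_gt0//; lra.
(* At the endpoint the exponent of the pointwise bound is exactly that of the profile in
   [lorentz_norm_ge]. *)
have pE : - p^-1 = r^-1 - 1 by rewrite /p; field; lra.
pose A := K * 2 `^ (- p^-1).
have A0 : 0 < A by rewrite mulr_gt0 ?powR_gt0.
(* The absolute value makes [M] nonnegative, so that [M] is recovered as the [1/s] power of
   [M^s]. *)
pose M := `|C| * p * 16^-1 `^ p^-1 / A.
have M0 : 0 <= M.
  by rewrite /M divr_ge0 ?(ltW A0)// mulr_ge0 ?powR_ge0// mulr_ge0 ?(ltW p0).
(* With [u = 4/N] and [v = 1/16] the quotient [v / (4 u)] is [N / 256]; this [N] makes its logarithm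
   exceed [M^s]. *)
pose N := Num.bound (256 * expR (M `^ s)).
have NM : 256 * expR (M `^ s) < N%:R by apply: archi_boundP; rewrite mulr_ge0// expR_ge0.
have E1 : 1 <= expR (M `^ s) by rewrite -expR0 ler_expR powR_ge0.
have N256 : 256 < N%:R :> R by lra.
have N0 : 0 < N%:R :> R by lra.
have a01 : 0 < (16 * N%:R : R)^-1 <= 1.
  by rewrite invr_gt0 invf_le1; [|lra]; apply/andP; split; lra.
have := HC _ (in_Lorentz_pulse a01 p0); apply/negP; rewrite -ltNge.
apply: (@le_lt_trans _ _ (`|C| * (p * (16 * N%:R)^-1 `^ p^-1))%:E).
  apply: (@le_trans _ _
    (`|C|%:E * lorentz_norm nu p 1 (abs_fun (pulse (16 * N%:R)^-1)))%E).
    by rewrite lee_wpmul2r ?poweR_ge0// lee_fin ler_norm.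
  by rewrite EFinM lee_wpmul2l ?lee_fin// lorentz_norm_pulse_le.
apply: (@lt_le_trans _ _ (K * N%:R `^ (- p^-1) * 2 `^ (- p^-1) *
    (ln (16^-1 / (4 * (4 / N%:R)))) `^ s^-1)%:E).
  have NV : N%:R^-1 `^ p^-1 = N%:R `^ (- p^-1) :> R.
    by rewrite -powR_inv1 ?(ltW N0)// -powRrM mulN1r.
  rewrite lte_fin invfM powRM ?invr_ge0 ?(ltW N0)// NV.
  have -> : `|C| * (p * (16^-1 `^ p^-1 * N%:R `^ (- p^-1))) = A * N%:R `^ (- p^-1) * M.
    by rewrite /M; field; lra.
  have -> : K * N%:R `^ (- p^-1) * 2 `^ (- p^-1) = A * N%:R `^ (- p^-1).
    by rewrite /A; ring.
  rewrite ltr_pM2l ?mulr_gt0 ?powR_gt0//.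
  have -> : 16^-1 / (4 * (4 / N%:R)) = N%:R / 256 :> R by field; lra.
  have {1}-> : M = (M `^ s) `^ s^-1 by rewrite -powRrM divff ?gt_eqF// powRr1.
  have Ml : M `^ s < ln (N%:R / 256).
    by rewrite -[ltLHS]expRK ltr_ln ?posrE ?expR_gt0 ?divr_gt0// ltr_pdivlMr// mulrC.
  rewrite gt0_ltr_powR ?invr_gt0 ?nnegrE ?powR_ge0//.
  by rewrite (le_trans (powR_ge0 M s))// ltW.
have u0 : 0 < 4 / N%:R :> R by rewrite divr_gt0.
apply: lorentz_norm_ge => //.
- by rewrite mulr_ge0 ?powR_ge0// ltW.
- by rewrite mulrA ltr_pdivrMr//; lra.
- lra.
move=> x /andP[ux xv]; have x0 : 0 < x by exact: lt_le_trans ux.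
rewrite -mulrA -powRM ?(ltW N0) ?(ltW x0)// pE.
apply: VK; rewrite ?x0//.
by rewrite mulrC -ler_pdivrMr.
Qed.

End Unbounded.

Theorem mainTheorem3 (R : realType) (r : R) (hr : 2 < r) :
  (forall p : R, 1 <= p -> p < r / (r - 1) ->
    ~ (exists C : R, forall f : R -> R[i], in_Lp p f ->
        ('N[torus_measure R]_(p%:E) [fourier_variation r f]
           <= C%:E * 'N[torus_measure R]_(p%:E) [abs_fun f])%E))
  /\
  (forall s : R, 1 <= s ->
    ~ (exists C : R, forall f : R -> R[i], in_Lorentz (r / (r - 1)) 1 f ->
        (lorentz_norm (torus_measure R) (r / (r - 1)) s (fourier_variation r f)
           <= C%:E * lorentz_norm (torus_measure R) (r / (r - 1)) 1 (abs_fun f))%E)).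
Proof.
split=> ? *; first exact: fourier_variation_unbounded_Lp.
exact: fourier_variation_unbounded_Lorentz.
Qed.
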